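(* Let $M$ and $N$ be even positive integers, let $A=(w_{i,j})$ be a real $M\times N$ matrix satisfying $$w_{i,j}=w_{M-i+1,\,N-j+1}\qquad (1\le i\le M,\ 1\le j\le N),$$ and let $p=(p_1,\ldots,p_M)\in\mathbb{R}^M$. Let $A^{(1)},A^{(2)}$ be the $\frac M2\times\frac N2$ matrices and $p^{(1)},p^{(2)}\in\mathbb{R}^{M/2}$ the vectors built from $A$ and $p$ as defined in the context. Suppose $f^{(1)}=(f^{(1)}_1,\ldots,f^{(1)}_{N/2})\in\mathbb{R}^{N/2}$ is a solution of $A^{(1)}f^{(1)}=p^{(1)}$ and $f^{(2)}=(f^{(2)}_1,\ldots,f^{(2)}_{N/2})\in\mathbb{R}^{N/2}$ is a solution of $A^{(2)}f^{(2)}=p^{(2)}$. Then the vector $f=(f_1,\ldots,f_N)\in\mathbb{R}^N$ given by $$f_j=\frac{f^{(2)}_j+f^{(1)}_j}{2},\qquad f_{N-j+1}=\frac{f^{(2)}_j-f^{(1)}_j}{2},\qquad j=1,\ldots,\frac N2,$$ is a solution of the system $Af=p$.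
   Context: Given a real $M\times N$ matrix $A=(w_{i,j})$ with $M,N$ even and a vector $p\in\mathbb{R}^M$, the matrices $A^{(1)}=(w^{(1)}_{i,j})$ and $A^{(2)}=(w^{(2)}_{i,j})$ of size $\frac M2\times\frac N2$ are defined by $$w^{(1)}_{i,j}=w_{i,j}-w_{M-i+1,j},\qquad w^{(2)}_{i,j}=w_{i,j}+w_{M-i+1,j},\qquad i=1,\ldots,\tfrac M2,\ j=1,\ldots,\tfrac N2,$$ and the vectors $p^{(1)},p^{(2)}\in\mathbb{R}^{M/2}$ are defined by $$p^{(1)}_i=p_i-p_{M-i+1},\qquad p^{(2)}_i=p_i+p_{M-i+1},\qquad i=1,\ldots,\tfrac M2.$$ Vectors are treated as column vectors in matrix-vector products. *)

(* Defs.v *)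
From HB Require Import structures.
From mathcomp Require Import all_boot all_order all_algebra.
From mathcomp Require Import reals.

Set Implicit Arguments.
Unset Strict Implicit.
Unset Printing Implicit Defensive.

Import Order.TTheory GRing.Theory Num.Theory.
Local Open Scope ring_scope.

Lemma leq_half_self (n : nat) : (n./2 <= n)%N.
Proof. by rewrite leq_half_double -addnn leqW ?leq_addl. Qed.

(* Indices are 0-based: the 1-based index i <= n/2 is [first_half i], and the
   1-based reflection i |-> n - i + 1 is [rev_ord], which sends i to n - 1 - i. *)
Definition first_half (n : nat) (i : 'I_(n./2)) : 'I_n :=
  widen_ord (leq_half_self n) i.

Definition mx_minus (R : realType) (M N : nat) (A : 'M[R]_(M, N)) :
    'M[R]_(M./2, N./2) :=
  \matrix_(i, j) (A (first_half i) (first_half j)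
                  - A (rev_ord (first_half i)) (first_half j)).

Definition mx_plus (R : realType) (M N : nat) (A : 'M[R]_(M, N)) :
    'M[R]_(M./2, N./2) :=
  \matrix_(i, j) (A (first_half i) (first_half j)
                  + A (rev_ord (first_half i)) (first_half j)).

Definition vec_minus (R : realType) (M : nat) (p : 'cV[R]_M) : 'cV[R]_(M./2) :=
  \col_i (p (first_half i) ord0 - p (rev_ord (first_half i)) ord0).

Definition vec_plus (R : realType) (M : nat) (p : 'cV[R]_M) : 'cV[R]_(M./2) :=
  \col_i (p (first_half i) ord0 + p (rev_ord (first_half i)) ord0).

(* Main.v *)
(* By the central symmetry, row i of A f pairs the columns j and N - j + 1 as
   w_{i,j} f_j + w_{M-i+1,j} f_{N-j+1}, which is half the sum of the j-th terms
   of rows i of A^(2) f^(2) and A^(1) f^(1).  Row M - i + 1 gives half their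
   difference in the same way. *)
Require Import Defs.
From HB Require Import structures.
From mathcomp Require Import all_boot all_order all_algebra.
From mathcomp Require Import reals.
From mathcomp Require Import zify ring.

Set Implicit Arguments.
Unset Strict Implicit.
Unset Printing Implicit Defensive.

Import Order.TTheory GRing.Theory Num.Theory.
Local Open Scope ring_scope.

(** Evenness matters: for odd [n] the middle index is its own mirror image and lies outside the
    first half. *)
Lemma rev_ord_lt_half (n : nat) (i : 'I_n) :
  ~~ odd n -> (rev_ord i < n./2)%N = ~~ (i < n./2)%N.
Proof.
move=> n_even; have := ltn_ord i; rewrite /= -leqNgt.
by have := even_halfK n_even; lia.
Qed.

(** Indexed by the ordinal itself, so that a case split on [halfP] replaces [i] throughout the goal
    by one of the two forms. *)
Variant half_spec (n : nat) : 'I_n -> Prop :=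
  | HalfLower (k : 'I_(n./2)) : half_spec (first_half k)
  | HalfUpper (k : 'I_(n./2)) : half_spec (rev_ord (first_half k)).

Lemma halfP (n : nat) (i : 'I_n) : ~~ odd n -> half_spec i.
Proof.
move=> n_even; have [lt_i|] := boolP (i < n./2)%N.
  by rewrite (_ : i = first_half (Ordinal lt_i)); [left | apply: val_inj].
rewrite -rev_ord_lt_half // => lt_i.
rewrite -[i]rev_ordK (_ : rev_ord i = first_half (Ordinal lt_i)); first by right.
exact: val_inj.
Qed.

Lemma sum_half (V : nmodType) (n : nat) (F : 'I_n -> V) :
  ~~ odd n ->
  \sum_i F i = \sum_(k < n./2) (F (first_half k) + F (rev_ord (first_half k))).
Proof.
move=> n_even; rewrite (bigID (fun i : 'I_n => (i < n./2)%N)) /=.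
(* Reflection carries the upper half onto the lower one, so both sums get the same range and
   merge. *)
rewrite [X in _ + X](reindex_inj rev_ord_inj).
under [X in _ + X]eq_bigl => i do rewrite rev_ord_lt_half // negbK.
by rewrite !(big_ord_narrow (leq_half_self n)) -big_split.
Qed.

Theorem theorem1 (R : realType) (M N : nat)
  (M_gt0 : (0 < M)%N) (N_gt0 : (0 < N)%N)
  (M_even : ~~ odd M) (N_even : ~~ odd N)
  (A : 'M[R]_(M, N))
  (A_sym : forall (i : 'I_M) (j : 'I_N), A i j = A (rev_ord i) (rev_ord j))
  (p : 'cV[R]_M)
  (f1 f2 : 'cV[R]_(N./2))
  (f1_sol : mx_minus A *m f1 = vec_minus p)
  (f2_sol : mx_plus A *m f2 = vec_plus p)
  (f : 'cV[R]_N)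
  (f_lower : forall j : 'I_(N./2),
     f (first_half j) ord0 = (f2 j ord0 + f1 j ord0) / 2%:R)
  (f_upper : forall j : 'I_(N./2),
     f (rev_ord (first_half j)) ord0 = (f2 j ord0 - f1 j ord0) / 2%:R) :
  A *m f = p.
Proof.
have minusE i : \sum_j (A (first_half i) (first_half j)
      - A (rev_ord (first_half i)) (first_half j)) * f1 j ord0
    = p (first_half i) ord0 - p (rev_ord (first_half i)) ord0.
  move/matrixP/(_ i ord0): f1_sol; rewrite !mxE => <-.
  by apply: eq_bigr => j _; rewrite mxE.
have plusE i : \sum_j (A (first_half i) (first_half j)
      + A (rev_ord (first_half i)) (first_half j)) * f2 j ord0
    = p (first_half i) ord0 + p (rev_ord (first_half i)) ord0.
  move/matrixP/(_ i ord0): f2_sol; rewrite !mxE => <-.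
  by apply: eq_bigr => j _; rewrite mxE.
apply/matrixP => i o; rewrite (ord1 o) mxE sum_half //.
case: (halfP i M_even) => k.
(* Splitting the entry of [p] this way exposes the right-hand sides of [plusE] and [minusE];
   substituting them leaves an identity that holds column by column. *)
- have -> : p (first_half k) ord0 =
      (p (first_half k) ord0 + p (rev_ord (first_half k)) ord0) / 2
      + (p (first_half k) ord0 - p (rev_ord (first_half k)) ord0) / 2 by field.
  rewrite -plusE -minusE !mulr_suml -big_split; apply: eq_bigr => j _ /=.
  (* Symmetry moves the reflection from the column to the row, leaving only entries that occur in
     [mx_minus A] and [mx_plus A]. *)
  by rewrite f_lower f_upper (A_sym _ (rev_ord _)) rev_ordK; field.
- have -> : p (rev_ord (first_half k)) ord0 =
      (p (first_half k) ord0 + p (rev_ord (first_half k)) ord0) / 2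
      - (p (first_half k) ord0 - p (rev_ord (first_half k)) ord0) / 2 by field.
  rewrite -plusE -minusE !mulr_suml -sumrB; apply: eq_bigr => j _ /=.
  (* Here row and column are both reflected, so symmetry removes both reflections. *)
  by rewrite f_lower f_upper (A_sym _ (rev_ord (first_half j))) !rev_ordK; field.
Qed.
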